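(* Let $A\subset\mathcal L(\mathcal H)$ be a unital $C^*$-algebra (acting nondegenerately on $\mathcal H$) and $T$ a (possibly unbounded) self-adjoint operator affiliated to $A$. Let $\mathcal F$ be a set of representations of $A$. (1) Let $\mathcal F$ be strictly norming. Then $T$ is invertible if, and only if, $\phi(T)$ is invertible for all $\phi\in\mathcal F$. (2) Let $\mathcal F$ be faithful. Then $T$ is invertible if, and only if, $\phi(T)$ is invertible for all $\phi\in\mathcal F$ and the set $\{\|\phi(T)^{-1}\| : \phi\in\mathcal F\}$ is bounded.
   Context: A representation of $A$ is a $*$-morphism $\phi:A\to\mathcal L(\mathcal H_\phi)$ into the bounded operators on a Hilbert space. A set $\mathcal F$ of representations of a unital $A$ is strictly norming if for every $a\in A$ there is $\phi\in\mathcal F$ with $\|a\|=\|\phi(a)\|$, and faithful if $\bigoplus_{\phi\in\mathcal F}\phi$ is injective. A self-adjoint operator $T$ on $\mathcal H$ is affiliated to $A\subset\mathcal L(\mathcal H)$ if $h(T)\in A$ for every continuous function $h$ on the spectrum of $T$ vanishing at infinity. It then defines a $*$-morphism $\theta_T:\mathcal C_0(\mathbb R)\to A$, $\theta_T(h)=h(T)$. In general, a $*$-morphism $\theta:\mathcal C_0(\mathbb R)\to B$ into a $C^*$-algebra $B$ is called an observable affiliated to $B$, with spectrum $\{\lambda\in\mathbb R: h(\lambda)=0\ \forall h\in\mathcal C_0(\mathbb R)\text{ with }\theta(h)=0\}$ (possibly empty); the spectrum of $\theta_T$ is the usual spectrum of $T$. For a representation $\phi$, $\phi(T)$ is the observable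 $\phi\circ\theta_T:\mathcal C_0(\mathbb R)\to\mathcal L(\mathcal H_\phi)$ (it need not come from a true operator). $T$ is invertible if it is bijective with bounded inverse, equivalently $0\notin\operatorname{Spec}(T)$. An observable is invertible if $0$ is not in its spectrum; for an invertible observable $\phi(T)$, $\|\phi(T)^{-1}\|$ is the inverse of the distance from $0$ to $\operatorname{Spec}(\phi(T))$ (equal to $0$ if the spectrum is empty). *)

(* Defs.v *)
From HB Require Import structures.
From mathcomp Require Import all_boot all_order all_algebra.
From mathcomp Require Import sesquilinear.
From mathcomp Require Import complex.
From mathcomp Require Import all_classical all_reals all_analysis.

Set Implicit Arguments.
Unset Strict Implicit.
Unset Printing Implicit Defensive.

Import Order.TTheory GRing.Theory Num.Theory.
Import numFieldNormedType.Exports.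

Local Open Scope classical_set_scope.
Local Open Scope ring_scope.
Local Open Scope complex_scope.

(* The inner product is linear in the first variable and conjugate-linear in
   the second one. *)
Record hilbert (R : realType) := Hilbert {
  hilbert_sort :> completeNormedModType R[i] ;
  inner_form : {dot hilbert_sort for @Num.conj R[i]} ;
  inner_norm : forall x : hilbert_sort, inner_form x x = `|x| ^+ 2 }.

Definition inner (R : realType) (H : hilbert R) (x y : H) : R[i] :=
  inner_form H x y.

(* The norm of MathComp-Analysis takes values in the field of scalars R[i]. *)
Definition rnorm (R : realType) (H : hilbert R) (x : H) : R :=
  complex.Re `|x|.

Section BoundedOperators.
Variables (R : realType) (H : hilbert R).

Definition bounded_op : set (H -> H) :=
  [set a | linear a /\ exists M : R, forall x, rnorm (a x) <= M * rnorm x].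

Definition opnorm (a : H -> H) : R :=
  sup [set rnorm (a x) | x in [set x | rnorm x <= 1]].

Definition is_adjoint (a b : H -> H) : Prop :=
  forall x y, inner (a x) y = inner x (b y).

Record cstar_algebra (A : set (H -> H)) : Prop := CstarAlgebra {
  cstar_bounded : A `<=` bounded_op ;
  cstar_0 : A (fun=> 0) ;
  cstar_add : forall a b, A a -> A b -> A (fun x => a x + b x) ;
  cstar_scale : forall (c : R[i]) a, A a -> A (fun x => c *: a x) ;
  cstar_mul : forall a b, A a -> A b -> A (a \o b) ;
  cstar_star : forall a, A a -> exists2 b, A b & is_adjoint a b ;
  cstar_closed : forall a, bounded_op a ->
    (forall e : R, 0 < e ->
       exists2 b, A b & opnorm (fun x => a x - b x) < e) ->
    A a }.

Definition unital (A : set (H -> H)) : Prop :=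
  exists2 e, A e & forall a, A a -> e \o a = a /\ a \o e = a.

(* The linear span of {a x | a in A, x in H} is dense. *)
Definition acts_nondegenerately (A : set (H -> H)) : Prop :=
  closure [set y : H | exists n (a : 'I_n -> H -> H) (x : 'I_n -> H),
    (forall i, A (a i)) /\ y = \sum_(i < n) a i (x i)] = setT.

End BoundedOperators.

Section Representations.
Variables (R : realType) (H : hilbert R) (A : set (H -> H)).

(* The values of rep_fun outside A are irrelevant.  A representation is not
   required to be unital or nondegenerate. *)
Record representation := Representation {
  rep_space : hilbert R ;
  rep_fun :> (H -> H) -> rep_space -> rep_space ;
  rep_bounded : forall a, A a -> bounded_op (rep_fun a) ;
  rep_add : forall a b, A a -> A b ->
    rep_fun (fun x => a x + b x) = (fun x => rep_fun a x + rep_fun b x) ;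
  rep_scale : forall (c : R[i]) a, A a ->
    rep_fun (fun x => c *: a x) = (fun x => c *: rep_fun a x) ;
  rep_mul : forall a b, A a -> A b ->
    rep_fun (a \o b) = rep_fun a \o rep_fun b ;
  rep_star : forall a b, A a -> A b -> is_adjoint a b ->
    is_adjoint (rep_fun a) (rep_fun b) }.

(* A set of representations is given as an indexed family, because set does
   not apply to a type as large as representation. *)
Definition strictly_norming (I : Type) (F : I -> representation) : Prop :=
  forall a, A a -> exists i, opnorm a = opnorm (F i a).

(* The Hilbert direct sum of the spaces of the members of F. *)
Definition l2_sum (I : Type) (F : I -> representation) :
    set (forall i, rep_space (F i)) :=
  [set x | (\esum_(i in [set: {classic I}])
              (rnorm (x i) ^+ 2)%:E < +oo)%E].

Definition direct_sum (I : Type) (F : I -> representation) (a : H -> H)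
    (x : forall i, rep_space (F i)) : forall i, rep_space (F i) :=
  fun i => F i a (x i).

Definition faithful (I : Type) (F : I -> representation) : Prop :=
  forall a b, A a -> A b ->
    (forall x, l2_sum (F := F) x -> direct_sum a x = direct_sum b x) -> a = b.

End Representations.

Section UnboundedOperators.
Variables (R : realType) (H : hilbert R).

(* The values of op_fun outside the domain are irrelevant. *)
Record operator := Operator {
  dom : set H ;
  op_fun :> H -> H ;
  dom_0 : dom 0 ;
  dom_linear : forall (c : R[i]) x y, dom x -> dom y -> dom (c *: x + y) ;
  op_linear : forall (c : R[i]) x y, dom x -> dom y ->
    op_fun (c *: x + y) = c *: op_fun x + op_fun y }.

(* Densely defined, and the graph of the adjoint, that is, the set of the
   (y, z) such that <T x, y> = <x, z> on the domain, is the graph of T. *)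
Definition selfadjoint (T : operator) : Prop :=
  closure (dom T) = setT /\
  forall y z, (forall x, dom T x -> inner (T x) y = inner x z) <->
              (dom T y /\ T y = z).

Definition is_inverse (T : operator) (B : H -> H) : Prop :=
  [/\ bounded_op B,
      forall y, dom T (B y) /\ T (B y) = y &
      forall x, dom T x -> B (T x) = x].

Definition invertible (T : operator) : Prop := exists B, is_inverse T B.

Lemma op_shift_linear (T : operator) (z c : R[i]) x y : dom T x -> dom T y ->
  T (c *: x + y) - z *: (c *: x + y) = c *: (T x - z *: x) + (T y - z *: y).
Proof.
move=> Tx Ty; rewrite op_linear// scalerDr scalerBr !scalerA opprD addrACA.
by rewrite (mulrC z).
Qed.

Definition op_shift (T : operator) (z : R[i]) : operator :=
  @Operator (dom T) (fun x => T x - z *: x) (dom_0 T) (@dom_linear T)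
    (@op_shift_linear T z).

Definition spectrum (T : operator) : set R[i] :=
  [set z | ~ invertible (op_shift T z)].

(* The spectrum of a self-adjoint operator, as a subset of the real line. *)
Definition real_spectrum (T : operator) : set R :=
  [set l | spectrum T l%:C].

End UnboundedOperators.

(* C_0(S) for a closed subset S of the real line.  Its elements are
   represented by functions on R whose values outside S are irrelevant. *)
Definition C0 (R : realType) (S : set R) : set (R -> R[i]) :=
  [set h : R -> R[i] | {within S, continuous (h : R -> R[i]^o)} /\
           forall e : R, 0 < e -> exists M : R, forall l, S l -> M < `|l| ->
             complex.Re `|h l| < e].

(* Phi is a *-morphism from C_0(S) to the bounded operators on K; for
   S = setT it is an observable affiliated to the bounded operators on K. *)
Record C0_morphism (R : realType) (S : set R) (K : hilbert R)
    (Phi : (R -> R[i]) -> K -> K) : Prop := C0Morphism {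
  C0_bounded : forall h, C0 S h -> bounded_op (Phi h) ;
  C0_ext : forall h g, C0 S h -> C0 S g -> (forall l, S l -> h l = g l) ->
    Phi h = Phi g ;
  C0_add : forall h g, C0 S h -> C0 S g ->
    Phi (fun l => h l + g l) = (fun x => Phi h x + Phi g x) ;
  C0_scale : forall (c : R[i]) h, C0 S h ->
    Phi (fun l => c * h l) = (fun x => c *: Phi h x) ;
  C0_mul : forall h g, C0 S h -> C0 S g ->
    Phi (fun l => h l * g l) = Phi h \o Phi g ;
  C0_star : forall h, C0 S h ->
    is_adjoint (Phi h) (Phi (fun l => Num.conj (h l))) }.

(* Phi is the functional calculus h |-> h(T) of the self-adjoint operator T:
   the unique *-morphism on C_0(Spec T) that sends l |-> 1 / (l - z) to the
   resolvent (T - z)^-1 for every nonreal z. *)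
Definition functional_calculus (R : realType) (H : hilbert R) (T : operator H)
    (Phi : (R -> R[i]) -> H -> H) : Prop :=
  C0_morphism (real_spectrum T) Phi /\
  forall z : R[i], complex.Im z != 0 ->
    is_inverse (op_shift T z) (Phi (fun l => (l%:C - z)^-1)).

(* T, with functional calculus Phi, is affiliated to A. *)
Definition affiliated (R : realType) (H : hilbert R) (A : set (H -> H))
    (T : operator H) (Phi : (R -> R[i]) -> H -> H) : Prop :=
  forall h, C0 (real_spectrum T) h -> A (Phi h).

Section Observables.
Variables (R : realType) (K : hilbert R) (theta : (R -> R[i]) -> K -> K).

Definition obs_spectrum : set R :=
  [set l | forall h, C0 setT h -> theta h = (fun=> 0) -> h l = 0].

Definition obs_invertible : Prop := ~ obs_spectrum 0.

(* The inverse of the distance from 0 to the spectrum; it is 0 if the spectrum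
   is empty, because inf set0 = 0 and 0^-1 = 0. *)
Definition obs_inv_norm : R := (inf [set `|l| | l in obs_spectrum])^-1.

End Observables.

(* The observable phi(T), as the restriction of phi o Phi to C_0(R), where Phi
   is the functional calculus of T. *)
Definition rep_obs (R : realType) (H : hilbert R) (A : set (H -> H))
    (phi : representation A) (Phi : (R -> R[i]) -> H -> H) :
    (R -> R[i]) -> rep_space phi -> rep_space phi :=
  fun h => phi (Phi h).
Arguments rep_obs {R H A} phi Phi.

(* Main.v *)
Require Import Defs.
From mathcomp Require Import all_boot all_order all_algebra.
From mathcomp Require Import complex.
From mathcomp Require Import all_classical all_reals all_analysis.
From mathcomp Require Import sesquilinear finmap ring lra.

Set Implicit Arguments.
Unset Strict Implicit.
Unset Printing Implicit Defensive.

Import Order.TTheory GRing.Theory Num.Theory.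
Import numFieldNormedType.Exports.

Local Open Scope classical_set_scope.
Local Open Scope ring_scope.
Local Open Scope complex_scope.

(** Write h(T) for Phi h, and let k(l) = 1 / (1 + l^2), so that
    k(T) = (T - i)^-1 (T + i)^-1 and 0 < k <= 1 = k(0).

    If T is invertible, a Neumann series shows that some interval ]-d, d[ does
    not meet the spectrum of T (invertible_shift).  Every h supported in that
    interval then satisfies h(T) = 0, hence phi(h(T)) = 0, so the spectrum of
    every phi(T) also avoids ]-d, d[ (rep_obs_spectrum_gap).  This gives the
    forward implications, with the uniform bound 1/d on the norms of the
    inverses.

    The converses rest on two facts.

    - If |k(T) x| <= c |x| for all x, with c < 1, then T is invertible
      (invertible_of_cauchy_fun): 1 - k(T) has a bounded inverse N by the
      Neumann series, T W = 1 - k(T) for an explicit combination W of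
      resolvents, and W N is the inverse of T.

    - If a *-morphism Psi on C_0 kills some h with h(0) <> 0, then
      |Psi(k) x| <= c |x| for some c < 1 (cauchy_fun_strict).  Indeed
      k = u + |h|^2 u with u = k / (1 + |h|^2), so Psi(k) = Psi(u); sup u < 1,
      and *-morphisms are contractive (C0_morphism_contractive).

    For a strictly norming family, choose phi with ||phi(k(T))|| = ||k(T)||.
    As phi(T) is invertible, the second fact for h |-> phi(h(T)) shows that
    this norm is < 1, and the first fact applies.

    For a faithful family, a bound on the norms of the inverses gives d > 0
    such that every Spec(phi(T)) avoids ]-d, d[.  By compactness a function h
    supported in [-d/2, d/2], with h(0) <> 0, is killed by all
    h |-> phi(h(T)) (tent_eq0_of_spectrum).  Faithfulness gives h(T) = 0, and
    the two facts, the second one with Psi = Phi, conclude. *)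

(** * The real-valued norm and bounded operators *)

Section RealNorm.
Variables (R : realType) (H : hilbert R).
Implicit Types x y z : H.

Lemma hilbert_normE x : `|x| = (rnorm x)%:C.
Proof. by rewrite /rnorm RRe_real// ger0_real. Qed.

Lemma rnorm_ge0 x : 0 <= rnorm x.
Proof. by rewrite -ler0c -hilbert_normE. Qed.

Lemma rnorm0 : rnorm (0 : H) = 0.
Proof. by rewrite /rnorm normr0. Qed.

Lemma rnorm_eq0 x : rnorm x = 0 -> x = 0.
Proof. by move=> x0; apply/eqP; rewrite -normr_eq0 hilbert_normE x0. Qed.

Lemma rnormD x y : rnorm (x + y) <= rnorm x + rnorm y.
Proof. by rewrite -lecR rmorphD/= -!hilbert_normE ler_normD. Qed.

Lemma rnormN x : rnorm (- x) = rnorm x.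
Proof. by rewrite /rnorm normrN. Qed.

Lemma rnormZ (c : R[i]) x : rnorm (c *: x) = complex.Re `|c| * rnorm x.
Proof.
apply: complexI.
by rewrite rmorphM/= -(hilbert_normE (c *: x)) -(hilbert_normE x) normrZ.
Qed.

Lemma rnormZR (c : R) x : rnorm (c%:C *: x) = `|c| * rnorm x.
Proof. by rewrite rnormZ normc_def /= expr0n addr0 sqrtr_sqr. Qed.

Lemma inner_rnorm x : inner x x = (rnorm x ^+ 2)%:C.
Proof. by rewrite /inner inner_norm hilbert_normE rmorphXn. Qed.

Lemma innerDl x y z : inner (x + y) z = inner x z + inner y z.
Proof. by rewrite /inner linearDl. Qed.

Lemma innerDr x y z : inner z (x + y) = inner z x + inner z y.
Proof. by rewrite /inner linearDr. Qed.

Lemma innerNl x y : inner (- x) y = - inner x y.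
Proof. by rewrite /inner linearNl. Qed.

Lemma innerNr x y : inner x (- y) = - inner x y.
Proof. by rewrite /inner linearNr. Qed.

Lemma innerZl (c : R[i]) x y : inner (c *: x) y = c * inner x y.
Proof. by rewrite /inner linearZl_LR. Qed.

Lemma innerZr (c : R[i]) x y : inner x (c *: y) = Num.conj c * inner x y.
Proof. by rewrite /inner linearZr. Qed.

End RealNorm.

Section BoundedLinear.
Variables (R : realType) (H : hilbert R) (a : H -> H).
Hypothesis a_bounded : bounded_op a.

Lemma bounded_opP (c : R[i]) x y : a (c *: x + y) = c *: a x + a y.
Proof. by case: a_bounded => aL _; exact: aL. Qed.

Lemma bounded_opD x y : a (x + y) = a x + a y.
Proof. by have := bounded_opP 1 x y; rewrite !scale1r. Qed.

Lemma bounded_op0 : a 0 = 0.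
Proof. by apply: (addrI (a 0)); rewrite -bounded_opD !addr0. Qed.

Lemma bounded_opZ (c : R[i]) x : a (c *: x) = c *: a x.
Proof. by rewrite -[c *: x]addr0 bounded_opP bounded_op0 addr0. Qed.

Lemma bounded_opN x : a (- x) = - a x.
Proof. by rewrite -scaleN1r bounded_opZ scaleN1r. Qed.

Lemma bounded_opB x y : a (x - y) = a x - a y.
Proof. by rewrite bounded_opD bounded_opN. Qed.

Lemma bounded_op_bound :
  exists2 M : R, 0 < M & forall x, rnorm (a x) <= M * rnorm x.
Proof.
case: a_bounded => _ [M aM]; exists (`|M| + 1) => [|x].
  by rewrite ltr_wpDl.
by apply: (le_trans (aM x)); rewrite ler_wpM2r ?rnorm_ge0// ler_wpDr// ler_norm.
Qed.

(** The supremum of an unbounded set is 0, so the bound on a is needed. *)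
Lemma rnorm_le_opnorm x : rnorm (a x) <= opnorm a * rnorm x.
Proof.
have [M M0 aM] := bounded_op_bound.
have a1 y : rnorm y <= 1 -> rnorm (a y) <= opnorm a.
  move=> y1; apply: ub_le_sup; last by exists y.
  exists M => _ [u /= u1 <-]; apply: (le_trans (aM u)).
  by rewrite -[leRHS]mulr1 ler_wpM2l// ltW.
have [x0|x0] := eqVneq (rnorm x) 0.
  by rewrite x0 mulr0 (rnorm_eq0 x0) bounded_op0 rnorm0.
have x_gt0 : 0 < rnorm x by rewrite lt_def x0 rnorm_ge0.
have := a1 ((rnorm x)^-1%:C *: x).
rewrite bounded_opZ !rnormZR ger0_norm ?invr_ge0 ?rnorm_ge0// mulVf//.
by move=> /(_ (lexx _)); rewrite mulrC ler_pdivrMr.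
Qed.

End BoundedLinear.

Lemma opnorm_le (R : realType) (H : hilbert R) (a : H -> H) (c : R) :
  0 <= c -> (forall x, rnorm (a x) <= c * rnorm x) -> opnorm a <= c.
Proof.
move=> c0 ac; apply: ge_sup.
  by exists (rnorm (a 0)), 0; rewrite //= rnorm0.
move=> _ [u /= u1 <-]; apply: (le_trans (ac u)).
by rewrite -[leRHS]mulr1 ler_wpM2l.
Qed.

(** * Neumann series *)

Section Neumann.
Variables (R : realType) (H : hilbert R) (a : H -> H) (c : R).
Hypotheses (a_bounded : bounded_op a) (c_ge0 : 0 <= c) (c_lt1 : c < 1).
Hypothesis ac : forall x, rnorm (a x) <= c * rnorm x.

Lemma contraction_fixed0 x : a x = x -> x = 0.
Proof.
move=> ax; apply: rnorm_eq0; apply/eqP; rewrite eq_le rnorm_ge0 andbT.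
rewrite -(@pmulr_rle0 _ (1 - c)) ?subr_gt0// mulrBl mul1r subr_le0.
by rewrite -{1}ax.
Qed.

Lemma neumann_solution y : exists x, x = y + a x.
Proof.
(* The iterates u n are the partial sums of the series of the a^k y. *)
pose f x := y + a x; pose u n := iter n f 0.
have c1 : 0 < 1 - c by rewrite subr_gt0.
pose K := rnorm y / (1 - c).
have K0 : 0 <= K by rewrite divr_ge0 ?rnorm_ge0// ltW.
have uS n : u n.+1 = y + a (u n) by [].
have u_le n : rnorm (u n) <= K.
  elim: n => [|n IH]; first by rewrite rnorm0.
  apply: (le_trans (rnormD _ _)); apply: (@le_trans _ _ (rnorm y + c * K)).
    by rewrite lerD2l; apply: (le_trans (ac _)); rewrite ler_wpM2l.
  rewrite -lerBrDr /K -[X in _ <= X - _]mul1r -mulrBl.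
  by rewrite mulrC divfK ?gt_eqF.
have u_dist n m : rnorm (u (n + m)%N - u n) <= K * c ^+ n.
  elim: n => [|n IH]; first by rewrite add0n expr0 mulr1 subr0.
  rewrite addSn !uS opprD addrACA subrr add0r -bounded_opB// exprS mulrCA.
  by apply: (le_trans (ac _)); rewrite ler_wpM2l.
have K_small (e : R) : 0 < e -> exists n, K * c ^+ n < e.
  move=> e0; have /cvgr0Pnorm_lt : (fun n => K * c ^+ n) @ \oo --> (0 : R).
    rewrite -(mulr0 K); apply: cvgM; first exact: cvg_cst.
    by apply: cvg_expr; rewrite ger0_norm.
  move=> /(_ e e0) [n _ /(_ n (leqnn _))].
  by move=> /=/(le_lt_trans (ler_norm _)) Kn; exists n.
have ball_rnorm (p q : H) (e : R) : ball p e%:C q <-> rnorm (p - q) < e.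
  by rewrite -ball_normE /ball_/= hilbert_normE ltcR.
have real_gt0 (e : R[i]) : 0 < e -> exists2 r : R, e = r%:C & 0 < r.
  move=> e0; exists (complex.Re e); first by rewrite RRe_real// gtr0_real.
  by rewrite -ltcR RRe_real// gtr0_real.
have ucvg : cvg (u @ \oo).
  apply/cauchy_cvgP/cauchy_exP => _ /real_gt0[e -> e0].
  have [n Kn] := K_small e e0; exists (u n); exists n => // m /= nm.
  apply/ball_rnorm; rewrite -rnormN opprB -(subnKC nm).
  exact: (le_lt_trans (u_dist _ _)).
exists (lim (u @ \oo)); set x := lim _.
apply/subr0_eq/rnorm_eq0/eqP; rewrite eq_le rnorm_ge0 andbT.
apply/ler_addgt0Pl => e e0; rewrite addr0.
have /cvg_ball /(_ (e / 2)%:C) : u @ \oo --> x by [].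
rewrite ltcR divr_gt0// => /(_ isT)[n _ un].
have /un/ball_rnorm xn : (n <= n)%N by [].
have /un/ball_rnorm xSn : (n <= n.+1)%N by [].
have -> : x - (y + a x) = (x - u n.+1) + a (u n - x).
  by rewrite uS bounded_opB// !opprD !addrA subrK.
apply: (le_trans (rnormD _ _)); rewrite (splitr e) lerD// ?ltW//.
apply: (le_lt_trans (ac _)); rewrite -rnormN opprB; apply: le_lt_trans xn.
by rewrite ler_piMl ?rnorm_ge0// ltW.
Qed.

(** N is the inverse of 1 - a. *)
Lemma neumann_inverse : exists2 N, bounded_op N & forall y, N y - a (N y) = y.
Proof.
have [N NP] := choice neumann_solution.
have N1 y : N y - a (N y) = y by rewrite {1}NP addrK.
have aN y : a (N y) = N y - y by rewrite -{3}(N1 y) subKr.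
exists N => //; split=> [d x y|].
  apply/subr0_eq/contraction_fixed0.
  rewrite (bounded_opB a_bounded) (bounded_opP a_bounded) !aN scalerBr.
  by rewrite [in X in _ - X]addrACA -opprD opprB addrA subrK.
exists (1 - c)^-1 => y; rewrite mulrC ler_pdivlMr ?subr_gt0// mulrBr mulr1.
rewrite lerBlDr {1}NP mulrC; apply: (le_trans (rnormD _ _)).
by rewrite lerD2l.
Qed.

End Neumann.

Section Composition.
Variables (R : realType) (H : hilbert R).
Implicit Types a b : H -> H.

Lemma bounded_op_comp a b :
  bounded_op a -> bounded_op b -> bounded_op (a \o b).
Proof.
move=> a_bd b_bd; split=> [c x y|].
  by rewrite /= (bounded_opP b_bd) (bounded_opP a_bd).
have [[M M0 aM] [N N0 bN]] := (bounded_op_bound a_bd, bounded_op_bound b_bd).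
exists (M * N) => x /=; apply: (le_trans (aM _)).
by rewrite -mulrA ler_wpM2l// ltW.
Qed.

Lemma bounded_op_scaleD (c : R[i]) a b :
  bounded_op a -> bounded_op b -> bounded_op (fun x => c *: a x + b x).
Proof.
move=> a_bd b_bd; split=> [d x y|].
  rewrite (bounded_opP a_bd) (bounded_opP b_bd) !scalerDr !scalerA addrACA.
  by rewrite [c * d]mulrC.
have [[M M0 aM] [N N0 bN]] := (bounded_op_bound a_bd, bounded_op_bound b_bd).
exists (complex.Re `|c| * M + N) => x; apply: (le_trans (rnormD _ _)).
rewrite rnormZ mulrDl lerD// -mulrA ler_wpM2l//.
by rewrite -ler0c RRe_real ?ger0_real.
Qed.

End Composition.

(** * Invertibility of unbounded operators *)

Section Invertibility.
Variables (R : realType) (H : hilbert R).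
Implicit Types (T : operator H) (B C : H -> H).

Lemma right_inverse_is_inverse T C : bounded_op C ->
    (forall y, dom T (C y) /\ T (C y) = y) ->
    (forall x, dom T x -> T x = 0 -> x = 0) ->
  is_inverse T C.
Proof.
move=> C_bd TC T_inj; split=> // x Tx; have [dC TCx] := TC (T x).
apply/subr0_eq/T_inj.
  by rewrite -[C _]scale1r addrC -scaleN1r scale1r; apply: dom_linear.
by rewrite addrC -scaleN1r op_linear// TCx scaleN1r addNr.
Qed.

(** The resolvent set of T contains a real neighbourhood of 0 if it contains 0:
    T - l = (1 - l B) T for the inverse B of T. *)
Lemma invertible_shift T : invertible T ->
  exists2 d : R, 0 < d & forall l, real_spectrum T l -> d <= `|l|.
Proof.
move=> [B [B_bd TB BT]]; have [M M0 BM] := bounded_op_bound B_bd.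
exists M^-1 => [|l]; first by rewrite invr_gt0.
apply: contra_notP => /negP; rewrite -ltNge => lM.
pose a x := l%:C *: B x.
have a_bd : bounded_op a.
  have B0_bd : bounded_op (fun _ : H => 0 : H).
    split=> [c x y|]; first by rewrite scaler0 addr0.
    by exists 0 => x; rewrite rnorm0 mul0r.
  suff -> : a = (fun x => l%:C *: B x + 0) by exact: bounded_op_scaleD.
  by apply/funext => x; rewrite addr0.
have aM x : rnorm (a x) <= `|l| * M * rnorm x.
  by rewrite rnormZR -mulrA ler_wpM2l.
have lM1 : `|l| * M < 1 by rewrite -ltr_pdivlMr ?div1r.
have lM0 : 0 <= `|l| * M by rewrite mulr_ge0// ltW.
have [N N_bd N1] := neumann_inverse a_bd lM0 lM1 aM.
exists (B \o N); apply: right_inverse_is_inverse.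
- exact: bounded_op_comp.
- by move=> y /=; have [dB ->] := TB (N y); split=> //; exact: N1.
move=> x Tx /= /subr0_eq Txl; apply: (contraction_fixed0 lM1 aM).
by rewrite /a -(bounded_opZ B_bd) -Txl BT.
Qed.

(** Here j is i or -i, and Rp Rm = (T - j)^-1 (T + j)^-1 = (1 + T^2)^-1. *)
Lemma invertible_of_resolvents T (j : R[i]) (Rp Rm : H -> H) (c : R) :
    j * j = -1 -> is_inverse (op_shift T j) Rp ->
    is_inverse (op_shift T (- j)) Rm ->
    0 <= c -> c < 1 -> (forall x, rnorm (Rp (Rm x)) <= c * rnorm x) ->
  invertible T.
Proof.
move=> jj [Rp_bd TRp RpT] [Rm_bd TRm RmT] c0 c1 RRc.
have RR_bd : bounded_op (Rp \o Rm) by exact: bounded_op_comp.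
have [N N_bd N1] := neumann_inverse RR_bd c0 c1 RRc.
(* T W = 1 - Rp Rm, because T Rp = 1 + j Rp and T Rm = 1 - j Rm. *)
pose W := fun y => j *: (Rp \o Rm) y + Rm y.
have W_bd : bounded_op W by exact: bounded_op_scaleD.
have TW y : dom T (W y) /\ T (W y) = y - Rp (Rm y).
  have [/= dp Tp] := TRp (Rm y); have [/= dm Tm] := TRm y.
  split; first exact: dom_linear.
  rewrite /W op_linear//= -[T (Rp _)](subrK (j *: Rp (Rm y))) Tp.
  rewrite scalerDr scalerA jj scaleN1r.
  rewrite -[T (Rm y)](subrK (- j *: Rm y)) Tm scaleNr.
  by rewrite addrCA addrAC subrr add0r addrC.
exists (W \o N); apply: right_inverse_is_inverse.
- exact: bounded_op_comp.
- by move=> y /=; have [dW ->] := TW (N y); split=> //; exact: N1.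
(* If T x = 0 then Rp x = j x and Rm x = - j x, so Rp Rm x = x. *)
move=> x dx Tx; apply: (contraction_fixed0 c1 RRc) => /=.
have xp : x = - j *: Rp x.
  by rewrite -(bounded_opZ Rp_bd) -{1}(RpT x dx) /= Tx sub0r scaleNr.
have xm : x = j *: Rm x.
  by rewrite -(bounded_opZ Rm_bd) -{1}(RmT x dx) /= Tx sub0r scaleNr opprK.
have {}xp : Rp x = j *: x by rewrite {2}xp scalerA mulrN jj opprK scale1r.
have {}xm : Rm x = - j *: x by rewrite {2}xm scalerA mulNr jj opprK scale1r.
by rewrite xm (bounded_opZ Rp_bd) xp scalerA mulNr jj opprK scale1r.
Qed.

End Invertibility.

(** * Continuous functions vanishing at infinity *)

(** The modulus of a complex number, as a real number. *)
Definition modulus (R : realType) (z : R[i]) : R := complex.Re `|z|.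
Arguments modulus : simpl never.

Section Modulus.
Variable R : realType.
Implicit Types z w : R[i].

Lemma modulusE z : `|z| = (modulus z)%:C.
Proof. by rewrite /modulus RRe_real// ger0_real. Qed.

Lemma modulus_ge0 z : 0 <= modulus z.
Proof. by rewrite -ler0c -modulusE. Qed.

Lemma modulusM z w : modulus (z * w) = modulus z * modulus w.
Proof. by apply: complexI; rewrite rmorphM/= -!modulusE normrM. Qed.

Lemma modulusV z : modulus z^-1 = (modulus z)^-1.
Proof. by apply: complexI; rewrite fmorphV/= -!modulusE normfV. Qed.

Lemma modulusR (c : R) : modulus c%:C = `|c|.
Proof. by rewrite /modulus normc_def/= expr0n addr0 sqrtr_sqr. Qed.

Lemma modulus_conj z : modulus (Num.conj z) = modulus z.
Proof. by rewrite /modulus norm_conjC. Qed.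

Lemma conj_real_complex (c : R) : Num.conj c%:C = c%:C :> R[i].
Proof. exact: conjc_real. Qed.

Lemma mul_conj_modulus z : z * Num.conj z = (modulus z ^+ 2)%:C.
Proof. by rewrite -normCK modulusE rmorphXn. Qed.

Lemma modulus_sqr z : modulus z ^+ 2 = complex.Re z ^+ 2 + complex.Im z ^+ 2.
Proof. by apply: complexI; rewrite add_Re2_Im2 modulusE rmorphXn. Qed.

Lemma modulus_eq0 z : modulus z = 0 -> z = 0.
Proof. by move=> z0; apply/eqP; rewrite -normr_eq0 modulusE z0. Qed.

Lemma ler_dist_modulus z w : `|modulus z - modulus w| <= modulus (z - w).
Proof.
have tri (u v : R[i]) : modulus (u + v) <= modulus u + modulus v.
  by rewrite -lecR rmorphD/= -!modulusE ler_normD.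
have modN (u : R[i]) : modulus (- u) = modulus u by rewrite /modulus normrN.
rewrite ler_norml; apply/andP; split.
  by rewrite lerNl opprB lerBlDr -(modN (z - w)) opprB -{1}(subrK z w) tri.
by rewrite lerBlDr -{1}(subrK w z) tri.
Qed.

Lemma complex_continuousP (h : R -> R[i]^o) :
  continuous h <-> forall l (e : R), 0 < e ->
    \forall t \near l, modulus (h l - h t) < e.
Proof.
split=> [h_cont l e e0|h_cont l].
  have /cvgrPdist_lt/(_ e%:C) := h_cont l; rewrite ltcR => /(_ e0).
  by apply: filterS => t /=; rewrite modulusE ltcR.
apply/cvgrPdist_lt => e e0; have eE : e = (complex.Re e)%:C.
  by rewrite RRe_real// gtr0_real.
rewrite eE; near=> t; rewrite modulusE ltcR; near: t; apply: h_cont.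
by rewrite -ltcR -eE.
Unshelve. all: by end_near. Qed.

Lemma modulus_continuous (h : R -> R[i]^o) :
  continuous h -> continuous (fun l => modulus (h l)).
Proof.
move=> /complex_continuousP h_cont l; apply/cvgrPdist_lt => e e0.
near=> t; apply: (le_lt_trans (ler_dist_modulus _ _)).
by near: t; exact: h_cont.
Unshelve. all: by end_near. Qed.

Lemma sqr_modulus_continuous (h : R -> R[i]^o) :
  continuous h -> continuous (fun l => modulus (h l) ^+ 2).
Proof.
move=> h_cont l.
apply: (@continuous_comp _ _ _ (fun l => modulus (h l)) (fun t => t ^+ 2)).
  exact: modulus_continuous.
exact: exprn_continuous.
Qed.

Lemma real_continuous (f : R -> R) :
  continuous f -> continuous ((fun l => (f l)%:C) : R -> R[i]^o).
Proof.
move=> f_cont; apply/complex_continuousP => l e e0; near=> t.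
rewrite -rmorphB modulusR; near: t.
by have /cvgrPdist_lt/(_ e e0) := f_cont l.
Unshelve. all: by end_near. Qed.

Lemma conj_continuous (h : R -> R[i]^o) :
  continuous h -> continuous ((fun l => Num.conj (h l)) : R -> R[i]^o).
Proof.
move=> /complex_continuousP h_cont; apply/complex_continuousP => l e e0.
near=> t; rewrite -rmorphB modulus_conj; near: t; exact: h_cont.
Unshelve. all: by end_near. Qed.

End Modulus.

(** The real-valued function f vanishes at infinity. *)
Definition vanishing (R : realType) (f : R -> R) : Prop :=
  forall e : R, 0 < e -> exists M : R, forall l, M < `|l| -> `|f l| < e.

Section C0Functions.
Variable R : realType.
Implicit Types (f g : R -> R) (h k : R -> R[i]) (S : set R).

Lemma C0_setTP h : C0 setT h <->
  continuous (h : R -> R[i]^o) /\ vanishing (fun l => modulus (h l)).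
Proof.
rewrite /C0 /=; split=> -[h_cont h0]; split.
- by move=> l; have := h_cont l; rewrite /continuous_at nbhs_subspaceT.
- move=> e /h0[M hM]; exists M => l Ml.
  by rewrite ger0_norm ?modulus_ge0//; exact: hM.
- exact: continuous_subspaceT.
- move=> e /h0[M hM]; exists M => l _ Ml.
  by apply: le_lt_trans (hM l Ml); exact: ler_norm.
Qed.

Lemma C0_subset S h : C0 setT h -> C0 S h.
Proof.
move=> /C0_setTP[h_cont h0]; split; first exact: continuous_subspaceT.
move=> e /h0[M hM]; exists M => l _ Ml.
by apply: le_lt_trans (hM l Ml); exact: ler_norm.
Qed.

Lemma C0_real f : continuous f -> vanishing f -> C0 setT (fun l => (f l)%:C).
Proof.
move=> f_cont f0; apply/C0_setTP; split; first exact: real_continuous.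
move=> e /f0[M fM]; exists M => l /fM.
by rewrite modulusR normr_id.
Qed.

Lemma C0_conj h : C0 setT h -> C0 setT (fun l => Num.conj (h l)).
Proof.
move=> /C0_setTP[h_cont h0]; apply/C0_setTP; split.
  exact: conj_continuous.
by under eq_fun do rewrite modulus_conj.
Qed.

Lemma C0_prod h k : C0 setT h -> C0 setT k -> C0 setT (fun l => h l * k l).
Proof.
move=> /C0_setTP[h_cont h0] /C0_setTP[k_cont k0]; apply/C0_setTP; split.
  by move=> l; apply: (@cvgM _ _ (nbhs l) _ h k); [exact: h_cont|exact: k_cont].
move=> e e0; have [[M hM] [N kN]] := (h0 e e0, k0 1 ltr01).
exists (Num.max M N) => l; rewrite gt_max => /andP[Ml Nl].
rewrite modulusM normrM -[ltRHS]mulr1 ltr_pM//; first exact: hM.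
exact: kN.
Qed.

Lemma C0_scaled (a : R[i]) h : C0 setT h -> C0 setT (fun l => a * h l).
Proof.
move=> /C0_setTP[h_cont h0]; apply/C0_setTP; split.
  move=> l; apply: (@cvgM _ _ (nbhs l) _ (fun=> a) h); first exact: cvg_cst.
  exact: h_cont.
move=> e e0; have a0 : 0 < modulus a + 1 by rewrite ltr_wpDl ?modulus_ge0.
have [M hM] := h0 _ (divr_gt0 e0 a0); exists M => l /hM.
rewrite !ger0_norm ?modulus_ge0// modulusM ltr_pdivlMr// mulrDr mulr1 mulrC.
by apply: le_lt_trans; rewrite lerDl modulus_ge0.
Qed.

Lemma vanishing_le f g :
  (forall l, `|f l| <= `|g l|) -> vanishing g -> vanishing f.
Proof.
by move=> fg g0 e /g0[M gM]; exists M => l /gM; exact: le_lt_trans.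
Qed.

(** The function l |-> 1 / (1 + l^2), which takes its maximal value 1 only at
    0; its value at T is (1 + T^2)^-1. *)
Definition cauchy_fun (l : R) : R := (1 + l ^+ 2)^-1.

Lemma cauchy_fun_continuous : continuous cauchy_fun.
Proof.
move=> l; apply: cvgV; first by rewrite gt_eqF// ltr_wpDr// sqr_ge0.
by apply: cvgD; [exact: cvg_cst | exact: exprn_continuous].
Qed.

Lemma cauchy_fun_vanishing : vanishing cauchy_fun.
Proof.
move=> e e0; exists (1 + e^-1) => l Ml.
have l1 : 1 <= `|l|.
  by apply: ltW (le_lt_trans _ Ml); rewrite lerDl invr_ge0 ltW.
have pos : 0 < 1 + l ^+ 2 by rewrite ltr_wpDr// sqr_ge0.
rewrite /cauchy_fun normfV (gtr0_norm pos) invf_plt ?posrE//.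
apply: (@lt_trans _ _ (1 + e^-1)); first by rewrite ltr_pwDl.
apply: (lt_le_trans Ml); rewrite ler_wpDl// -real_normK ?num_real//.
by rewrite expr2 ler_peMl.
Qed.

Lemma C0_resolvent (j : R[i]) : complex.Re j = 0 -> complex.Im j ^+ 2 = 1 ->
  C0 setT (fun l => (l%:C - j)^-1).
Proof.
move=> j_re j_im.
have mj l : modulus (l%:C - j) ^+ 2 = 1 + l ^+ 2.
  by rewrite modulus_sqr !raddfB/= j_re subr0 sub0r sqrrN j_im addrC.
have mj0 l : 0 < modulus (l%:C - j).
  by rewrite lt_def modulus_ge0 andbT -sqrf_eq0 mj gt_eqF// ltr_wpDr// sqr_ge0.
apply/C0_setTP; split.
  move=> l; apply: (@cvgV _ _ (nbhs l) _ (fun l => l%:C - j)).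
    by apply/eqP => l0; move: (mj0 l); rewrite l0 modulusR normr0 ltxx.
  apply: cvgB; last exact: cvg_cst.
  by apply: (@real_continuous R id) => ?; exact: cvg_id.
move=> e e0; have [M fM] := cauchy_fun_vanishing (exprn_gt0 2 e0).
exists M => l /fM; rewrite modulusV /cauchy_fun -mj -exprVn.
by rewrite normrX ltr_pXn2r ?nnegrE// ltW.
Qed.

(** For d > 0, the tent function of height d supported in [-d, d]. *)
Definition tent (d l : R) : R := Num.max 0 (d - `|l|).

Lemma tent_continuous d : continuous (tent d).
Proof.
move=> l; apply: (@continuous_max R R (fun=> 0) (fun t => d - `|t|)).
  exact: cvg_cst.
by apply: cvgB; [exact: cvg_cst | exact: norm_continuous].
Qed.

Lemma tent_gt0 d l : `|l| < d -> 0 < tent d l.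
Proof. by move=> ld; rewrite lt_max subr_gt0 ld orbT. Qed.

Lemma tent_eq0 d l : d <= `|l| -> tent d l = 0.
Proof. by move=> dl; apply/max_idPl; rewrite subr_le0. Qed.

Lemma tent_vanishing d : vanishing (tent d).
Proof.
by move=> e e0; exists d => l dl; rewrite tent_eq0 ?normr0// ltW.
Qed.

Lemma C0_tent d : C0 setT (fun l => (tent d l)%:C).
Proof. by apply: C0_real; [exact: tent_continuous|exact: tent_vanishing]. Qed.

End C0Functions.

(** * Morphisms on C_0 *)

Section Morphism.
Variables (R : realType) (S : set R) (K : hilbert R).
Variable Psi : (R -> R[i]) -> K -> K.
Hypothesis Psi_mor : C0_morphism S Psi.
Local Notation realfun f := (fun l => (f l)%:C).

Lemma C0_morphism_eq0 h k : C0 setT h -> C0 setT k -> Psi h = (fun=> 0) ->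
  Psi (fun l => h l * k l) = (fun=> 0).
Proof.
move=> h0 k0 Ph; rewrite (C0_mul Psi_mor) ?Ph//; exact: C0_subset.
Qed.

Lemma C0_morphism_selfadjoint (f : R -> R) x y : C0 setT (realfun f) ->
  inner (Psi (realfun f) x) y = inner x (Psi (realfun f) y).
Proof.
move=> f0; rewrite (C0_star Psi_mor (C0_subset S f0)).
by congr (inner _ (Psi _ _)); apply/funext => l; exact: conj_real_complex.
Qed.

(** The bound on f gives a real p in C_0 with (c - p)^2 = c^2 - f^2, so that
    c^2 |x|^2 - |Psi(f) x|^2 = |(c - Psi(p)) x|^2 is nonnegative. *)
Lemma C0_morphism_contractive (f : R -> R) (c : R) x :
  continuous f -> vanishing f -> (forall l, `|f l| <= c) ->
  rnorm (Psi (realfun f) x) <= c * rnorm x.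
Proof.
move=> f_cont f0 fc.
have c0 : 0 <= c by apply: le_trans (fc 0).
have f2 l : f l ^+ 2 <= c ^+ 2.
  by rewrite -real_normK ?num_real// ler_pXn2r ?nnegrE.
pose p l := c - Num.sqrt (c ^+ 2 - f l ^+ 2).
have sqrtK l : Num.sqrt (c ^+ 2 - f l ^+ 2) ^+ 2 = c ^+ 2 - f l ^+ 2.
  by rewrite sqr_sqrtr// subr_ge0.
have p_cont : continuous p.
  move=> l; apply: cvgB; first exact: cvg_cst.
  apply: (@continuous_comp _ _ _ (fun l => c ^+ 2 - f l ^+ 2) Num.sqrt);
    last exact: sqrt_continuous.
  apply: cvgB; first exact: cvg_cst.
  apply: (@continuous_comp _ _ _ f (fun t => t ^+ 2)); first exact: f_cont.
  exact: exprn_continuous.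
have p_le l : `|p l| <= `|f l|.
  have s0 : 0 <= Num.sqrt (c ^+ 2 - f l ^+ 2) by exact: sqrtr_ge0.
  have sc : Num.sqrt (c ^+ 2 - f l ^+ 2) <= c.
    by rewrite -(@ler_pXn2r _ 2) ?nnegrE// sqrtK gerBl sqr_ge0.
  rewrite ger0_norm ?subr_ge0// lerBlDr -lerBlDl -(@ler_pXn2r _ 2) ?nnegrE//.
    rewrite sqrtK sqrrB real_normK ?num_real// -mulr_natl.
    have := fc l; have := normr_ge0 (f l).
    by rewrite -[f l ^+ 2]real_normK ?num_real//; nra.
  by rewrite subr_ge0.
have C0f := C0_real f_cont f0.
have C0p := C0_real p_cont (vanishing_le p_le f0).
have C0pp := C0_prod C0p C0p.
have PfPf y : Psi (realfun f) (Psi (realfun f) y) =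
    (2 * c)%:C *: Psi (realfun p) y - Psi (realfun p) (Psi (realfun p) y).
  transitivity (Psi (fun l =>
      (2 * c)%:C * (p l)%:C + -1 * ((p l)%:C * (p l)%:C)) y).
    rewrite -[LHS]/((Psi _ \o Psi _) _) -(C0_mul Psi_mor);
      [|exact: C0_subset..].
    congr (Psi _ _); apply/funext => l.
    rewrite -(rmorphN1 (real_complex R)) -!rmorphM -rmorphD; congr (_%:C).
    by have := sqrtK l; rewrite /p; set s := Num.sqrt _ => s2; ring: s2.
  rewrite (C0_add Psi_mor); [|by apply/C0_subset/C0_scaled..].
  rewrite !(C0_scale Psi_mor); [|exact: C0_subset..].
  by rewrite (C0_mul Psi_mor) ?scaleN1r//; exact: C0_subset.
suff norm2 : rnorm (Psi (realfun f) x) ^+ 2 +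
    rnorm (c%:C *: x - Psi (realfun p) x) ^+ 2 = (c * rnorm x) ^+ 2.
  rewrite -(@ler_pXn2r _ 2) ?nnegrE ?mulr_ge0 ?rnorm_ge0//.
  by rewrite -norm2 lerDl sqr_ge0.
apply: complexI; rewrite exprMn rmorphD [RHS]rmorphM/= -!inner_rnorm.
rewrite (C0_morphism_selfadjoint _ _ C0f) PfPf innerDr innerNr innerZr.
rewrite -(C0_morphism_selfadjoint x (Psi (realfun p) x) C0p).
rewrite !(innerDr, innerDl, innerNr, innerNl, innerZl, innerZr).
rewrite !conj_real_complex.
rewrite (C0_morphism_selfadjoint x x C0p).
rewrite rmorphM rmorphXn rmorph_nat /=.
ring.
Qed.

(** If Psi kills h and h(0) <> 0, then the norm of Psi(k), for
    k(l) = 1 / (1 + l^2), is less than k(0) = 1. *)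
Lemma cauchy_fun_strict h : C0 setT h -> Psi h = (fun=> 0) -> h 0 != 0 ->
  exists c : R, [/\ 0 <= c, c < 1 &
    forall x, rnorm (Psi (realfun (@cauchy_fun R)) x) <= c * rnorm x].
Proof.
move=> C0h Ph h00.
have [/sqr_modulus_continuous m_cont _] := (C0_setTP h).1 C0h.
pose m l := modulus (h l) ^+ 2; rewrite -/m in m_cont.
have m_ge0 l : 0 <= m l by exact: sqr_ge0.
have m1 l : 0 < 1 + m l by rewrite ltr_wpDr.
have m0 : 0 < m 0.
  rewrite lt_def m_ge0 andbT sqrf_eq0; apply: contra_neq h00.
  exact: modulus_eq0.
(* k = u + |h|^2 u, and the second term is killed by Psi. *)
pose u l := cauchy_fun l / (1 + m l).
have u_cont : continuous u.
  move=> l; apply: cvgM; first exact: cauchy_fun_continuous.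
  apply: cvgV; first by rewrite gt_eqF.
  by apply: cvgD; [exact: cvg_cst|exact: m_cont].
have k_gt0 (l : R) : 0 < cauchy_fun l by rewrite invr_gt0 ltr_wpDr// sqr_ge0.
have u_gt0 l : 0 < u l by rewrite divr_gt0.
have u_van : vanishing u.
  apply: vanishing_le (@cauchy_fun_vanishing R) => l.
  by rewrite !gtr0_norm// ler_pdivrMr// ler_peMr ?lerDl// ltW.
have C0u := C0_real u_cont u_van.
have PkE : Psi (realfun (@cauchy_fun R)) = Psi (realfun u).
  have C0w : C0 setT (fun l => Num.conj (h l) * (u l)%:C).
    by apply: C0_prod => //; exact: C0_conj.
  have C0hw := C0_prod C0h C0w.
  have -> : realfun (@cauchy_fun R) =
      (fun l => (u l)%:C + h l * (Num.conj (h l) * (u l)%:C)).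
    apply/funext => l; rewrite mulrA mul_conj_modulus -rmorphM -rmorphD.
    congr (_%:C); rewrite -/(m l) -[X in X + _]mul1r -mulrDl mulrC.
    by rewrite divfK ?gt_eqF.
  rewrite (C0_add Psi_mor); [|exact: C0_subset..].
  by rewrite (C0_morphism_eq0 C0h C0w Ph); apply/funext => x; rewrite addr0.
(* Near 0 the factor 1 / (1 + |h|^2) keeps u away from 1; elsewhere k does. *)
have [e e0 em] : exists2 e : R, 0 < e & forall l, `|l| < e -> m 0 / 2 < m l.
  have /cvgrPdist_lt/(_ (m 0 / 2)) := m_cont 0.
  rewrite divr_gt0// => /(_ isT)/nbhs_ballP[e /= e0 eP]; exists e => // l le.
  have := eP l; rewrite -ball_normE /= sub0r normrN => /(_ le).
  by rewrite ltr_norml => /andP[_]; lra.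
pose c := Num.max (1 + m 0 / 2)^-1 (1 + e ^+ 2)^-1.
exists c; split.
- by rewrite le_max invr_ge0 addr_ge0// ltW// divr_gt0.
- have m2 : 0 < m 0 / 2 by rewrite divr_gt0.
  have e2 : 0 < e ^+ 2 by rewrite exprn_gt0.
  by rewrite gt_max !invf_lt1 ?ltrDl ?m2// ltr_wpDr// ltW.
move=> x; rewrite PkE; apply: C0_morphism_contractive => // l.
rewrite gtr0_norm// le_max; have [le|el] := ltP `|l| e; apply/orP.
  left; rewrite /u /cauchy_fun -[leRHS]mul1r.
  rewrite ler_pM ?invr_ge0 ?addr_ge0 ?sqr_ge0//.
    by rewrite invf_le1 ?lerDl ?sqr_ge0// ltr_wpDr ?sqr_ge0.
  by rewrite lef_pV2 ?posrE ?lerD2l ?ltW ?em// ltr_wpDr// divr_ge0.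
right; rewrite /u /cauchy_fun -[leRHS]mulr1.
rewrite ler_pM ?invr_ge0 ?addr_ge0 ?sqr_ge0//.
  rewrite lef_pV2 ?posrE ?ltr_wpDr ?sqr_ge0// lerD2l.
  rewrite -[l ^+ 2]real_normK ?num_real//.
  by rewrite ler_pXn2r// nnegrE ltW.
by rewrite invf_le1 ?lerDl.
Qed.

End Morphism.

(** * The spectrum of an observable *)

Section ObservableSpectrum.
Variables (R : realType) (K : hilbert R) (Psi : (R -> R[i]) -> K -> K).
Hypothesis Psi_mor : C0_morphism setT Psi.
Local Notation realfun f := (fun l => (f l)%:C).

(** The nonnegative real functions of C_0 that Psi kills. *)
Definition nonneg_kernel (g : R -> R) : Prop :=
  [/\ continuous g, vanishing g, forall l, 0 <= g l &
      Psi (realfun g) = (fun=> 0)].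

Lemma nonneg_kernel_add f g : nonneg_kernel f -> nonneg_kernel g ->
  nonneg_kernel (fun l => f l + g l).
Proof.
move=> [f_cont f0 f_ge0 Pf] [g_cont g0 g_ge0 Pg]; split.
- by move=> l; apply: cvgD; [exact: f_cont|exact: g_cont].
- move=> e e0; have e2 : 0 < e / 2 by rewrite divr_gt0.
  have [[M fM] [N gN]] := (f0 _ e2, g0 _ e2); exists (Num.max M N) => l.
  rewrite gt_max => /andP[Ml Nl]; rewrite (splitr e).
  by apply: (le_lt_trans (ler_normD _ _)); rewrite ltrD// ?fM// gN.
- by move=> l; rewrite addr_ge0.
- under eq_fun do rewrite rmorphD.
  rewrite (C0_add Psi_mor) ?Pf ?Pg; [|exact: C0_real..].
  by apply/funext => x; rewrite addr0.
Qed.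

(** A function h killed by Psi gives |h|^2. *)
Lemma nonneg_kernel_pos l : ~ obs_spectrum Psi l ->
  exists2 g, nonneg_kernel g & 0 < g l.
Proof.
move=> /existsNP[h /not_implyP[C0h /not_implyP[Ph /eqP hl]]].
have [/sqr_modulus_continuous m_cont m0] := (C0_setTP h).1 C0h.
exists (fun l => modulus (h l) ^+ 2); last first.
  rewrite lt_def sqr_ge0 andbT sqrf_eq0; apply: contra_neq hl.
  exact: modulus_eq0.
split.
- exact: m_cont.
- move=> e e0; have [M mM] := m0 _ (@ltr01 R).
  have [N mN] := m0 _ e0; exists (Num.max M N) => t.
  rewrite gt_max => /andP[Mt Nt]; rewrite normrX expr2 -[ltRHS]mulr1.
  by rewrite ltr_pM// ?mM// mN.
- by move=> t; exact: sqr_ge0.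
- under eq_fun do rewrite -mul_conj_modulus.
  by rewrite (C0_morphism_eq0 Psi_mor C0h) //; exact: C0_conj.
Qed.

(** Compactness of [-d/2, d/2] gives a function g killed by Psi and positive on
    that interval; the tent function is a multiple of g. *)
Lemma tent_eq0_of_spectrum (d : R) : 0 < d ->
  (forall l, obs_spectrum Psi l -> d <= `|l|) ->
  Psi (realfun (tent (d / 2))) = (fun=> 0).
Proof.
move=> d0 spec_d; pose r := d / 2.
have rd : r < d by rewrite /r; lra.
have r0 : 0 < r by rewrite /r; lra.
have notin l : ~ (`|l| <= r /\ obs_spectrum Psi l).
  by move=> [lr /spec_d]; rewrite leNgt (le_lt_trans lr rd).
have /choice[G GP] : forall l, exists g : R -> R,
    `|l| <= r -> nonneg_kernel g /\ 0 < g l.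
  move=> l.
  have [lr|/negP lr] := boolP (`|l| <= r); last by exists (fun=> 0).
  have [g gk gl] := @nonneg_kernel_pos l (fun sl => notin l (conj lr sl)).
  by exists g.
have k0 : nonneg_kernel (fun=> 0).
  split=> //; first by move=> l; exact: cvg_cst.
    by move=> e e0; exists 0 => l _; rewrite normr0.
  have C00 : C0 setT (fun _ : R => 0 : R[i]).
    apply: (@C0_real R (fun=> 0)); first by move=> l; exact: cvg_cst.
    by move=> e e0; exists 0 => l _; rewrite normr0.
  have := C0_scale Psi_mor 0 C00; under eq_fun do rewrite mul0r.
  by move=> ->; apply/funext => x; rewrite scale0r.
(* A finite sum of the G l is killed by Psi and positive wherever one of them
   is. *)
have kernel_seq (s : seq R) : (forall l, l \in s -> `|l| <= r) ->
    exists2 g, nonneg_kernel g & forall l t, l \in s -> 0 < G l t -> 0 < g t.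
  elim: s => [|a s IH] sr; first by exists (fun=> 0).
  have [|g gk gP] := IH; first by move=> l ls; apply: sr; rewrite inE ls orbT.
  have [ak _] : nonneg_kernel (G a) /\ _ := GP a (sr a (mem_head _ _)).
  exists (fun l => G a l + g l); first exact: nonneg_kernel_add.
  case: (ak) (gk) => _ _ a_ge0 _ [_ _ g_ge0 _] l t.
  rewrite inE => /orP[/eqP ->|ls] Gt; first by rewrite ltr_wpDr.
  by rewrite ltr_wpDl// (gP l).
have : compact `[- r, r] by exact: segment_compact.
rewrite compact_cover.
move=> /(_ R [set l | `|l| <= r] (fun l => [set t | 0 < G l t])).
case.
- move=> l lr; have [[G_cont _ _ _] _] := GP l lr.
  apply: (@open_comp _ _ (G l) [set y | 0 < y]); last exact: open_gt.
  by move=> t _; exact: G_cont.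
- move=> t /=; rewrite in_itv /= -ler_norml => tr; exists t => //=.
  by have [] := GP t tr.
move=> D Dr cov; have [|g gk gP] := kernel_seq (enum_fset D).
  by move=> l /Dr/set_mem.
case: (gk) => g_cont g_van g_ge0 Pg.
have g_gt0 t : `|t| <= r -> 0 < g t.
  rewrite ler_norml => tr; have [|l /= lD Gt] := cov t.
    by rewrite /= in_itv.
  by apply: (gP l t) => //.
have [c cr mc] : exists2 c, `|c| <= r & forall t, `|t| <= r -> g c <= g t.
  have [||c] := @EVT_min R g (- r) r; first by lra.
    exact: continuous_subspaceT.
  rewrite in_itv/= -ler_norml => cr cP; exists c => // t tr; apply: cP.
  by rewrite in_itv/= -ler_norml.
have m0 := g_gt0 c cr; set m := g c in mc m0.
(* w = max(g, m) is continuous, bounded below by m > 0, and equal to g on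
   [-r, r]; hence tent r = g (tent r / w) everywhere. *)
pose w l := Num.max (g l) m.
have w_gt0 l : 0 < w l by rewrite lt_max m0 orbT.
pose q l := tent r l / w l.
have q_cont : continuous q.
  move=> l; apply: cvgM; first exact: tent_continuous.
  apply: cvgV; first by rewrite gt_eqF.
  by apply: (@continuous_max R R g (fun=> m)); [exact: g_cont|exact: cvg_cst].
have q_van : vanishing q.
  by move=> e e0; exists r => l rl; rewrite /q tent_eq0 ?mul0r ?normr0// ltW.
have -> : realfun (tent r) = (fun l => (g l)%:C * (q l)%:C).
  apply/funext => l; rewrite -rmorphM; congr (_%:C).
  have [lr|rl] := leP `|l| r; last by rewrite /q tent_eq0 ?mul0r ?mulr0// ltW.
  have wl : w l = g l by apply/max_idPl; exact: mc.
  by rewrite /q wl mulrC divfK// gt_eqF// g_gt0.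
have [C0g C0q] := (C0_real g_cont g_van, C0_real q_cont q_van).
exact: (C0_morphism_eq0 Psi_mor C0g C0q Pg).
Qed.

Lemma obs_spectrum_gap : obs_invertible Psi ->
  exists2 d : R, 0 < d & forall l, obs_spectrum Psi l -> d <= `|l|.
Proof.
move=> /nonneg_kernel_pos[g [g_cont g_van g_ge0 Pg] g0].
have /cvgrPdist_lt/(_ (g 0) g0)/nbhs_ballP[e /= e0 eP] := g_cont 0.
exists e => // l; apply: contraPP => /negP; rewrite -ltNge => le spec_l.
have := eP l; rewrite -ball_normE /= sub0r normrN => /(_ le).
have /complexI -> := spec_l _ (C0_real g_cont g_van) Pg.
by rewrite subr0 gtr0_norm// ltxx.
Qed.

Lemma obs_inv_norm_le (d : R) : 0 < d ->
  (forall l, obs_spectrum Psi l -> d <= `|l|) -> 0 <= obs_inv_norm Psi <= d^-1.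
Proof.
move=> d0 spec_d; rewrite /obs_inv_norm; set D := image _ _.
have [->|/set0P D0] := eqVneq D set0.
  by rewrite inf0 invr0 lexx invr_ge0 ltW.
have dinf : d <= inf D by apply: lb_le_inf => // _ [l /spec_d dl <-].
rewrite invr_ge0 (le_trans (ltW d0) dinf) /= lef_pV2// posrE.
exact: lt_le_trans dinf.
Qed.

(** Invertibility is needed: if 0 were in the spectrum, the distance would be 0
    and obs_inv_norm would be 0^-1 = 0. *)
Lemma obs_spectrum_ge (M : R) : obs_invertible Psi -> 0 < M ->
  obs_inv_norm Psi <= M -> forall l, obs_spectrum Psi l -> M^-1 <= `|l|.
Proof.
move=> /obs_spectrum_gap[d d0 spec_d] M0; rewrite /obs_inv_norm.
set D := image _ _ => DM l spec_l; have Dl : D `|l| by exists l.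
have dinf : d <= inf D.
  by apply: lb_le_inf; [exists (`|l|)|move=> _ [t /spec_d dt <-]].
have inf0 : 0 < inf D by exact: lt_le_trans dinf.
have infl : inf D <= `|l|.
  by apply: ge_inf => //; exists d => _ [t /spec_d dt <-].
by apply: le_trans infl; rewrite -[leRHS]invrK lef_pV2 ?posrE ?invr_gt0.
Qed.

End ObservableSpectrum.

(** * Functional calculus and representations *)

Section RepresentedOperator.
Variables (R : realType) (H : hilbert R) (A : set (H -> H)).
Hypothesis A_cstar : cstar_algebra A.
Variables (T : operator H) (Phi : (R -> R[i]) -> H -> H).
Hypothesis Phi_calculus : functional_calculus T Phi.
Hypothesis T_affiliated : affiliated A T Phi.
Local Notation realfun f := (fun l => (f l)%:C).

Lemma rep_zero (phi : representation A) : phi (fun=> 0) = (fun=> 0).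
Proof.
have := rep_scale phi 0 (cstar_0 A_cstar).
under eq_fun do rewrite scaler0.
by move=> ->; apply/funext => x; rewrite scale0r.
Qed.

Lemma rep_obs_morphism (phi : representation A) :
  C0_morphism setT (rep_obs phi Phi).
Proof.
have [Phi_mor _] := Phi_calculus.
have sub h : C0 setT h -> C0 (real_spectrum T) h by exact: C0_subset.
have APhi h : C0 setT h -> A (Phi h) by move=> /sub/T_affiliated.
rewrite /rep_obs; split.
- by move=> h C0h; apply: rep_bounded; exact: APhi.
- by move=> h g _ _ hg; congr (phi (Phi _)); apply/funext => l; exact: hg.
- move=> h g C0h C0g; rewrite (C0_add Phi_mor (sub _ C0h) (sub _ C0g)).
  by rewrite rep_add//; exact: APhi.
- move=> c h C0h; rewrite (C0_scale Phi_mor c (sub _ C0h)).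
  by rewrite rep_scale//; exact: APhi.
- move=> h g C0h C0g; rewrite (C0_mul Phi_mor (sub _ C0h) (sub _ C0g)).
  by rewrite rep_mul//; exact: APhi.
- move=> h C0h; apply: rep_star; [exact: APhi | exact/APhi/C0_conj |].
  exact: (C0_star Phi_mor (sub _ C0h)).
Qed.

Lemma calculus_eq0 h : C0 setT h -> (forall l, real_spectrum T l -> h l = 0) ->
  Phi h = (fun=> 0).
Proof.
have [Phi_mor _] := Phi_calculus => C0h h0.
have C0h' := C0_subset (real_spectrum T) C0h.
transitivity (Phi (fun l => 0 * h l)).
  apply: (C0_ext Phi_mor) => //; first exact/C0_subset/C0_scaled.
  by move=> l /h0 ->; rewrite mul0r.
by rewrite (C0_scale Phi_mor)//; apply/funext => x; rewrite scale0r.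
Qed.

(** The spectrum of phi(T) avoids the intervals ]-d, d[ that Spec(T) avoids. *)
Lemma rep_obs_spectrum_gap (d : R) :
    (forall l, real_spectrum T l -> d <= `|l|) ->
  forall (phi : representation A) l,
    obs_spectrum (rep_obs phi Phi) l -> d <= `|l|.
Proof.
move=> spec_d phi l spec_l; rewrite leNgt; apply/negP => /tent_gt0.
have /complexI -> : (tent d l)%:C = 0%:C; last by rewrite ltxx.
apply: (spec_l (realfun (tent d))); first exact: C0_tent.
rewrite /rep_obs calculus_eq0 ?rep_zero//; first exact: C0_tent.
by move=> t /spec_d/tent_eq0 ->.
Qed.

Lemma invertible_of_cauchy_fun (c : R) : 0 <= c -> c < 1 ->
    (forall x, rnorm (Phi (realfun (@cauchy_fun R)) x) <= c * rnorm x) ->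
  invertible T.
Proof.
have [Phi_mor Phi_res] := Phi_calculus => c0 c1 Phi_c.
have C0r (j : R[i]) : complex.Re j = 0 -> complex.Im j ^+ 2 = 1 ->
    C0 (real_spectrum T) (fun l => (l%:C - j)^-1).
  by move=> j_re j_im; apply/C0_subset/C0_resolvent.
have jm0 : complex.Re (- 'i : R[i]) = 0 by rewrite /= oppr0.
have jm1 : complex.Im (- 'i : R[i]) ^+ 2 = 1 by rewrite /= sqrrN expr1n.
have jp1 : complex.Im ('i : R[i]) ^+ 2 = 1 by rewrite /= expr1n.
have jj : 'i * 'i = -1 :> R[i] by rewrite -expr2 sqr_i.
apply: (invertible_of_resolvents jj (Phi_res 'i _) (Phi_res (- 'i) _) c0 c1).
- by rewrite /= oner_neq0.
- by rewrite /= oppr_eq0 oner_neq0.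
move=> x; apply: le_trans (Phi_c x).
rewrite -[X in rnorm X]/((Phi _ \o Phi _) x) -(C0_mul Phi_mor); [|exact: C0r..].
suff -> : (fun l : R => (l%:C - 'i)^-1 * (l%:C - - 'i)^-1) =
          realfun (@cauchy_fun R) by [].
apply/funext => l; rewrite /cauchy_fun -invfM fmorphV.
rewrite rmorphD rmorph1 rmorphXn /=.
by congr (_^-1); rewrite opprK -subr_sqr sqr_i opprK addrC.
Qed.

Lemma invertible_of_calculus_eq0 h : C0 setT h -> Phi h = (fun=> 0) ->
  h 0 != 0 -> invertible T.
Proof.
have [Phi_mor _] := Phi_calculus => C0h Ph h0.
have [c [c0 c1 Phi_c]] := cauchy_fun_strict Phi_mor C0h Ph h0.
exact: invertible_of_cauchy_fun Phi_c.
Qed.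

Lemma strictly_norming_invertible (I : Type) (F : I -> representation A) :
    strictly_norming F ->
    (forall i, obs_invertible (rep_obs (F i) Phi)) -> invertible T.
Proof.
move=> F_norming F_inv; pose k := realfun (@cauchy_fun R).
have C0k : C0 setT k.
  by apply: C0_real; [exact: cauchy_fun_continuous|exact: cauchy_fun_vanishing].
have Ak : A (Phi k) by apply/T_affiliated/C0_subset.
have [i norm_k] := F_norming _ Ak.
have /existsNP[h /not_implyP[C0h /not_implyP[Fh /eqP h0]]] := F_inv i.
have [c [c0 c1 Fc]] := cauchy_fun_strict (rep_obs_morphism (F i)) C0h Fh h0.
apply: (invertible_of_cauchy_fun c0 c1) => x.
apply: le_trans (rnorm_le_opnorm (cstar_bounded A_cstar Ak) x) _.
by rewrite ler_wpM2r ?rnorm_ge0// norm_k opnorm_le.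
Qed.

Lemma faithful_invertible (I : Type) (F : I -> representation A) (d : R) :
    faithful F -> 0 < d ->
    (forall i l, obs_spectrum (rep_obs (F i) Phi) l -> d <= `|l|) ->
  invertible T.
Proof.
move=> F_faithful d0 spec_d; pose h := realfun (tent (d / 2)).
have C0h : C0 setT h by exact: C0_tent.
apply: (invertible_of_calculus_eq0 C0h); last first.
  apply/eqP => /complexI t0; have := @tent_gt0 R (d / 2) 0.
  by rewrite t0 normr0 divr_gt0// ltxx => /(_ isT).
apply: F_faithful; [exact/T_affiliated/C0_subset | exact: cstar_0 | move=> x _].
apply/functional_extensionality_dep => i; rewrite /direct_sum rep_zero.
have := tent_eq0_of_spectrum (rep_obs_morphism (F i)) d0 (spec_d i).
by rewrite /rep_obs => ->.
Qed.

End RepresentedOperator.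

Theorem theorem5p8 (R : realType) (H : hilbert R) (A : set (H -> H))
    (A_cstar : cstar_algebra A) (A_unital : unital A)
    (A_nondegenerate : acts_nondegenerately A)
    (T : operator H) (T_selfadjoint : selfadjoint T)
    (Phi : (R -> complex R) -> H -> H)
    (Phi_calculus : functional_calculus T Phi)
    (T_affiliated : affiliated A T Phi)
    (I : Type) (F : I -> representation A) :
  (strictly_norming F ->
     (invertible T <-> forall i, obs_invertible (rep_obs (F i) Phi)))
  /\
  (faithful F ->
     (invertible T <->
      (forall i, obs_invertible (rep_obs (F i) Phi)) /\
      bounded_set (range (fun i => obs_inv_norm (rep_obs (F i) Phi))))).
Proof.
have gap : invertible T -> exists2 d : R, 0 < d &
    forall i l, obs_spectrum (rep_obs (F i) Phi) l -> d <= `|l|.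
  move=> /invertible_shift[d d0 spec_d]; exists d => // i l.
  exact: (rep_obs_spectrum_gap A_cstar Phi_calculus spec_d).
have obs_inv : invertible T -> forall i, obs_invertible (rep_obs (F i) Phi).
  move=> /gap[d d0 spec_d] i /spec_d.
  by rewrite normr0 leNgt d0.
split=> [F_norming|F_faithful]; split => //.
- exact: (strictly_norming_invertible A_cstar Phi_calculus T_affiliated).
- move=> T_inv; split; first exact: obs_inv.
  have [d d0 spec_d] := gap T_inv.
  exists d^-1; split; first exact: num_real.
  move=> M dM _ [i _ <-].
  have /andP[inv0 inv_d] := obs_inv_norm_le d0 (spec_d i).
  by rewrite /= ger0_norm// (le_trans inv_d)// ltW.
- move=> [F_inv [M [_ FM]]]; have M0 : 0 < `|M| + 1 by rewrite ltr_wpDl.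
  apply: (faithful_invertible A_cstar Phi_calculus T_affiliated F_faithful
    (d := (`|M| + 1)^-1)).
    by rewrite invr_gt0.
  move=> i.
  apply: (obs_spectrum_ge (rep_obs_morphism Phi_calculus T_affiliated _)) => //.
  have := FM (`|M| + 1) _ (obs_inv_norm (rep_obs (F i) Phi)).
  rewrite ltr_pwDr ?ler_norm// => /(_ isT) => FMi.
  by apply: le_trans (ler_norm _) (FMi _); exists i.
Qed.
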